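(* Let $n\ge1$ and let $\lambda\vdash n$ and $\rho\vdash(n-1)$ be arbitrary Young diagrams. Then the Kostka numbers satisfy $$\sum_{\mu\vdash n:\ \mu\succ\rho} K(\mu,\lambda)=\sum_{\gamma\vdash(n-1):\ \gamma\prec\lambda}c(\lambda,\gamma)\,K(\rho,\gamma).$$
   Context: $\lambda\vdash n$ means a Young diagram with $n$ cells (a partition of $n$). $\gamma\prec\lambda$ (equivalently $\lambda\succ\gamma$) means that $\lambda$ is obtained from $\gamma$ by adding exactly one cell. For $\mu,\lambda\vdash n$, the Kostka number $K(\mu,\lambda)$ is the number of semistandard tableaux (strictly increasing down every column, weakly increasing along every row) of shape $\mu$ and weight $\lambda$, i.e. in which the symbol $i$ occurs $\lambda_i$ times, where $\lambda_i$ is the length of the $i$th row of $\lambda$. For $\gamma\prec\lambda$, the coefficient $c(\lambda,\gamma)$ is the number of rows (blocks) of the partition $\lambda$ such that decreasing that row by one element yields (after reordering) the partition $\gamma$; equivalently, the number of rows of $\lambda$ whose length equals the length in $\lambda$ of the row being modified in passing from $\lambda$ to $\gamma$. *)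

(* Defs.v *)
From HB Require Import structures.
From mathcomp Require Import all_boot.

Set Implicit Arguments.
Unset Strict Implicit.
Unset Printing Implicit Defensive.

(* Rows, columns and symbols are numbered from 0. *)

Definition is_part (n : nat) (s : seq nat) : bool :=
  [&& sorted geq s, 0 \notin s & sumn s == n].

Record young (n : nat) := Young { rows :> seq nat; youngP : is_part n rows }.

HB.instance Definition _ n := [isSub for @rows n].
HB.instance Definition _ n := [Countable of young n by <:].

Lemma leq_mem_sumn (s : seq nat) x : x \in s -> x <= sumn s.
Proof.
elim: s => //= y s IHs; rewrite inE => /orP[/eqP-> | /IHs le_xs].
  exact: leq_addr.
exact: leq_trans le_xs (leq_addl _ _).
Qed.

Lemma size_part n s : is_part n s -> size s <= n.
Proof.
case/and3P=> _ s0 /eqP <-; elim: s s0 => //= x s IHs.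
rewrite inE negb_or eq_sym -lt0n => /andP[x_gt0 /IHs le_s].
by rewrite -addn1 addnC leq_add.
Qed.

Definition young_encode n (s : young n) : {bseq n of 'I_n.+1} :=
  insubd [bseq] [seq inord x | x <- s].
Definition young_decode n (t : {bseq n of 'I_n.+1}) : option (young n) :=
  insub [seq val x | x <- t].

Lemma young_encodeK n : pcancel (@young_encode n) (@young_decode n).
Proof.
move=> s; rewrite /young_decode /young_encode val_insubd size_map.
rewrite (size_part (youngP s)) -map_comp map_id_in ?valK // => x sx /=.
by rewrite inordK // ltnS; case/and3P: (youngP s) => _ _ /eqP <-; apply: leq_mem_sumn.
Qed.

HB.instance Definition _ n : isFinite (young n) :=
  PCanIsFinite (@young_encodeK n).

(* If [g] is followed by a gap before row [i], [incr_nth g i] contains a 0 and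
   so differs from every Young diagram. *)
Definition young_lt (m n : nat) (g : young m) (l : young n) : bool :=
  [exists i : 'I_(size l), rows l == incr_nth g i].

Definition cell (mu : seq nat) : finType := {i : 'I_(size mu) & 'I_(nth 0 mu i)}.
Definition crow (mu : seq nat) (c : cell mu) : nat := tag c.
Definition ccol (mu : seq nat) (c : cell mu) : nat := tagged c.

Definition semistandard (mu : seq nat) (k : nat) (T : {ffun cell mu -> 'I_k}) : bool :=
  [forall c, forall d,
     ((ccol c == ccol d) && (crow c < crow d) ==> (T c < T d)) &&
     ((crow c == crow d) && (ccol c < ccol d) ==> (T c <= T d))].

Definition has_weight (mu lam : seq nat) (T : {ffun cell mu -> 'I_(size lam)}) : bool :=
  [forall i : 'I_(size lam), #|[set c | T c == i]| == nth 0 lam i].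

Definition kostka (mu lam : seq nat) : nat :=
  #|[set T : {ffun cell mu -> 'I_(size lam)} | semistandard T && has_weight T]|.

(* A row decreased to length 0 disappears; [perm_eq] accounts for reordering. *)
Definition decr_row (s : seq nat) (i : nat) : seq nat :=
  [seq x <- set_nth 0 s i (nth 0 s i).-1 | 0 < x].

Definition coef (m n : nat) (l : young n) (g : young m) : nat :=
  #|[set i : 'I_(size l) | perm_eq (decr_row l i) g]|.

(* Main.v *)
Require Import Defs.
From mathcomp Require Import all_boot zify.

(** Let h_w be the product of the complete symmetric functions h_a for a in the
    weight w. The Kostka number K(mu, w) is the coefficient of the Schur
    function s_mu in h_w, and the left-hand side of the theorem is the
    coefficient of s_rho in D h_w, where D is the operator that removes one cell
    from a diagram in all possible ways. The theorem says that D acts on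
    products as a derivation with D h_a = h_(a-1), so that D h_w is the sum of
    the h_(w - e_i) over the rows i of w. The proof below is the
    combinatorial form of this remark.

    A semistandard tableau is built by adding, for each symbol in turn, the
    horizontal strip of the cells that contain it. So K(mu, w) counts the
    chains of horizontal strips with sizes prescribed by w ([kostka_chains]).
    Such chains are defined for every sequence w of natural numbers, so that
    w - e_i and the sequences met in inductions on w are again weights.

    The derivation rule is [D, h_a] = h_(a-1), that is, for fixed nu and rho,
    #{mu : mu covers rho, mu/nu is a strip} =
      #{sigma : nu covers sigma, rho/sigma is a strip} + [rho/nu is a strip],
    which is [card_cover_strips]: adding a cell to rho in row i + 1 on the left
    corresponds to removing a cell from nu in row i, and the extra 1 is the
    cell added in the top row. Induction on w turns this into [pieri], the
    expansion of the left-hand side as a sum over the positions i of w of the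
    number of chains from the empty diagram to rho with weight w - e_i.

    It remains to collect the positions i for which w - e_i rearranges to the
    same diagram gamma; coef counts them. For this the number of chains must
    not depend on the order of the weight, which is the commutation of h_a
    with h_b: [bender_knuth] reverses, for a diagram sigma between nu
    and mu, each row of sigma inside the interval of its possible lengths. *)

Set Implicit Arguments.
Unset Strict Implicit.
Unset Printing Implicit Defensive.

(** * Comparing cardinals through a relation *)

(** The correspondences below are read off from the entries of two diagrams or
    tableaux. Stating them as relations spares the construction of an explicit
    map, and of its inverse, between types that depend on sizes. *)
Lemma leq_card_rel (A B : finType) (P : pred A) (Q : pred B) (R : A -> B -> Prop) :
  (forall x, P x -> exists2 y, Q y & R x y) ->
  (forall x x' y, P x -> P x' -> R x y -> R x' y -> x = x') ->
  #|[pred x | P x]| <= #|[pred y | Q y]|.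
Proof.
move=> ex inj.
have /fin_all_exists[f fP]: forall x : A,
    exists y : option B, P x -> exists2 z, y = Some z & Q z /\ R x z.
  move=> x; case: (boolP (P x)) => [Px|_]; last by exists None.
  by have [z Qz Rz] := ex x Px; exists (Some z) => _; exists z.
have f_inj : {in P &, injective f}.
  move=> x x' Px Px' eq_f.
  have [z fx [_ Rz]] := fP x Px; have [z' fx' [_ Rz']] := fP x' Px'.
  have [eq_z] : Some z = Some z' by rewrite -fx -fx'.
  by apply: (inj x x' z) => //; rewrite eq_z.
have some_inj : injective (@Some B) by move=> y y' [].
rewrite -(card_in_image f_inj) -(card_image some_inj Q).
apply/subset_leq_card/subsetP=> _ /imageP[x Px ->].
by have [z -> [Qz _]] := fP x Px; apply: image_f.
Qed.

Lemma eq_card_rel (A B : finType) (P : pred A) (Q : pred B) (R : A -> B -> Prop) :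
  (forall x, P x -> exists2 y, Q y & R x y) ->
  (forall y, Q y -> exists2 x, P x & R x y) ->
  (forall x x' y, P x -> P x' -> R x y -> R x' y -> x = x') ->
  (forall x y y', Q y -> Q y' -> R x y -> R x y' -> y = y') ->
  #|[pred x | P x]| = #|[pred y | Q y]|.
Proof.
move=> exQ exP injP injQ; apply/eqP; rewrite eqn_leq (leq_card_rel exQ injP) /=.
by apply: (leq_card_rel (R := fun y x => R x y)) exP _ => y y' x; apply: injQ.
Qed.

(** * Young diagrams as nonincreasing functions *)

Lemma nth_gt0 (s : seq nat) j : 0 \notin s -> (0 < nth 0 s j) = (j < size s).
Proof.
move=> s0; case: (ltnP j (size s)) => [lt_js | le_sj]; last by rewrite nth_default.
by rewrite lt0n; apply: contraNneq s0 => <-; apply: mem_nth.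
Qed.

Lemma eq_nth0 (s t : seq nat) :
  0 \notin s -> 0 \notin t -> (forall j, nth 0 s j = nth 0 t j) -> s = t.
Proof.
move=> s0 t0 eq_st; apply: (@eq_from_nth _ 0) => [|j _]; last exact: eq_st.
have lt j : (j < size s) = (j < size t) by rewrite -!nth_gt0 ?eq_st.
by have := lt (size s); have := lt (size t); lia.
Qed.

Lemma sumn_nth (s : seq nat) N :
  size s <= N -> sumn s = \sum_(j < N) nth 0 s j.
Proof.
elim: N s => [|N IHN] [|x s] //=; rewrite ?big_ord0 // ?big_ord_recl //=.
- by move=> _; rewrite big1 // => j _; rewrite nth_default.
by rewrite ltnS => /IHN->.
Qed.

Lemma young0 n (s : young n) : 0 \notin rows s.
Proof. by case/and3P: (youngP s). Qed.

Lemma young_sumn n (s : young n) : sumn s = n.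
Proof. by case/and3P: (youngP s) => _ _ /eqP. Qed.

Lemma sorted_nth (s : seq nat) j : sorted geq s -> nth 0 s j.+1 <= nth 0 s j.
Proof.
move=> s_dec; case: (ltnP j.+1 (size s)) => [lt_js | le_sj].
  by have /(sortedP 0)/(_ j lt_js) := s_dec.
by rewrite nth_default.
Qed.

Lemma young_dec n (s : young n) j : nth 0 s j.+1 <= nth 0 s j.
Proof. by apply: sorted_nth; case/and3P: (youngP s). Qed.

Lemma young_eq n (s t : young n) : (forall j, nth 0 s j = nth 0 t j) -> s = t.
Proof. by move=> eq_st; apply/val_inj/eq_nth0; rewrite ?young0. Qed.

Lemma leq_dec (f : nat -> nat) :
  (forall j, f j.+1 <= f j) -> forall i j, i <= j -> f j <= f i.
Proof.
move=> f_dec i j /subnK<-; elim: (j - i) => //= d IHd.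
exact: leq_trans (f_dec _) IHd.
Qed.

Lemma young_mono n (s : young n) i j : i <= j -> nth 0 s j <= nth 0 s i.
Proof. exact: (leq_dec (f := nth 0 s) (young_dec s)). Qed.

(** Diagrams are handled below through the function giving the length of row j
    for every j, with value 0 beyond the last row; this is the way back. *)
Lemma ex_young (f : nat -> nat) N :
  (forall j, f j.+1 <= f j) -> f N = 0 ->
  exists s : young (\sum_(j < N) f j), forall j, nth 0 s j = f j.
Proof.
move=> f_dec fN; have ex0 : exists j, f j == 0 by exists N; apply/eqP.
pose M := ex_minn ex0.
have [fM0 Mmin] : f M = 0 /\ forall j, f j = 0 -> M <= j.
  by rewrite /M; case: ex_minnP => m /eqP fm mP; split=> // j /eqP; apply: mP.
have fmono := leq_dec f_dec.
pose s := mkseq f M.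
have nth_s j : nth 0 s j = f j.
  case: (ltnP j M) => [lt_jM | le_Mj]; first by rewrite nth_mkseq.
  by rewrite nth_default ?size_mkseq //; have := fmono _ _ le_Mj; lia.
have sP : is_part (\sum_(j < N) f j) s.
  apply/and3P; split.
  - apply/(sortedP 0)=> j _; rewrite !nth_s; exact: f_dec.
  - apply/negP=> /mapP[j]; rewrite mem_iota /= add0n => lt_jM /esym/Mmin; lia.
  rewrite (@sumn_nth _ N) ?size_mkseq ?Mmin //.
  by apply/eqP/eq_bigr=> j _; apply: nth_s.
by exists (Young sP).
Qed.

Lemma ex_young_seq n (s : seq nat) : sumn s = n ->
  (forall j, nth 0 s j.+1 <= nth 0 s j) ->
  exists t : young n, forall j, nth 0 t j = nth 0 s j.
Proof.
move=> <- s_dec; rewrite (sumn_nth (leqnn (size s))).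
by apply: ex_young => //; rewrite nth_default.
Qed.

(** A row that appears as new in [l] is necessarily the one just below [g],
    since [l] has no empty row. *)
Lemma young_ltP m n (g : young m) (l : young n) :
  reflect (exists i, forall j, nth 0 l j = nth 0 g j + (i == j)) (young_lt g l).
Proof.
apply: (iffP existsP) => [[i /eqP->] | [i eq_l]].
  by exists (val i) => j; rewrite nth_incr_nth addnC.
have lt_il : i < size l.
  by rewrite -nth_gt0 ?young0 // eq_l eqxx addn1.
exists (Ordinal lt_il); apply/eqP/eq_nth0 => /=; rewrite ?young0 //; last first.
  by move=> j; rewrite nth_incr_nth eq_l addnC.
apply/negP=> /(nthP 0)[j]; rewrite nth_incr_nth addnC -eq_l => lt_j /eqP.
rewrite -leqn0 leqNgt nth_gt0 ?young0 // => /negP[].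
move: lt_j; rewrite size_incr_nth; case: (ltnP i (size g)) => _ lt_j; last first.
  exact: leq_ltn_trans lt_il.
by rewrite -nth_gt0 ?young0 // eq_l addn_gt0 nth_gt0 ?young0 ?lt_j.
Qed.

(** * Horizontal strips and chains of strips *)

(** Interlacing of row lengths: it says that [nu] is contained in [mu] and that
    no two cells of the difference lie in the same column. Beyond the bound on j
    both sequences vanish. *)
Definition strip (mu nu : seq nat) : bool :=
  all (fun j => nth 0 mu j.+1 <= nth 0 nu j <= nth 0 mu j)
      (iota 0 (maxn (size mu) (size nu))).

Lemma stripP mu nu :
  reflect (forall j, nth 0 mu j.+1 <= nth 0 nu j <= nth 0 mu j) (strip mu nu).
Proof.
apply: (iffP allP) => mu_nu j => [|_]; last exact: mu_nu.
case: (ltnP j (maxn (size mu) (size nu))) => [lt_j | ]; last first.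
  by rewrite geq_max => /andP[le_mu le_nu]; rewrite !nth_default // ltnW.
by apply: mu_nu; rewrite mem_iota.
Qed.

Lemma leq_sumn_strip mu nu : strip mu nu -> sumn nu <= sumn mu.
Proof.
move/stripP=> mu_nu; set N := maxn (size mu) (size nu).
rewrite (@sumn_nth _ N) ?leq_maxr // (@sumn_nth mu N) ?leq_maxl //.
by apply: leq_sum => j _; case/andP: (mu_nu j).
Qed.

(** The head of the weight is the size of the last strip added, so a tableau
    whose symbols occur as prescribed by a sequence corresponds to a chain
    whose weight is the reversed sequence. The test on the total size makes the
    strip [mu / nu] have [a] cells. *)
Fixpoint chains (w mu : seq nat) : nat :=
  if w is a :: w' then
    \sum_(nu : young (sumn w') | strip mu nu && (sumn mu == a + sumn w'))
       chains w' nu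
  else mu == [::].

Arguments chains : simpl never.

Lemma chains_cons v a w mu : sumn w = v ->
  chains (a :: w) mu =
  \sum_(nu : young v | strip mu nu && (sumn mu == a + v)) chains w nu.
Proof. by move=> <-. Qed.

Lemma chains_size w mu : sumn mu != sumn w -> chains w mu = 0.
Proof.
case: w => [|a w] /=; first by case: mu => [|x mu] //.
move=> neq_s; rewrite (@chains_cons (sumn w)) //.
by rewrite big_pred0 // => nu; rewrite (negPf neq_s) andbF.
Qed.

(** * Independence of the order of the weight *)

(** The length of row j of a diagram between [nu] and [mu] ranges freely in the
    interval from [lo j] to [hi j], independently of the other rows. Reversing
    all these intervals maps a diagram s to t with s_j + t_j = lo j + hi j. As
    [lo j + hi j.+1 = nu_j + mu_(j+1)] (a maximum plus the minimum of the same
    two numbers) and [hi 0 = mu_0], the sizes of s and t add up to |mu| + |nu|,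
    so the sizes of the two strips are exchanged. The reverse inequality is the
    same statement with [a] and [b] exchanged. *)
Lemma bender_knuth a b v m (mu : young m) (nu : young v) : m = a + b + v ->
  #|[pred s : young (a + v) | strip mu s && strip s nu]| <=
  #|[pred s : young (b + v) | strip mu s && strip s nu]|.
Proof.
move=> def_m.
pose lo j := maxn (nth 0 nu j) (nth 0 mu j.+1).
pose hi j := if j is i.+1 then minn (nth 0 mu j) (nth 0 nu i) else nth 0 mu 0.
have lohi n (s : young n) : strip mu s && strip s nu ->
    forall j, lo j <= nth 0 s j <= hi j.
  case/andP=> /stripP mu_s /stripP s_nu j; rewrite geq_max.
  have /andP[-> mu_j] := mu_s j; have /andP[_ ->] := s_nu j.
  case: j mu_j => [|j] //= mu_j; rewrite leq_min mu_j.
  by case/andP: (s_nu j).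
pose R (s : young (a + v)) (t : young (b + v)) : Prop :=
  forall j, nth 0 s j + nth 0 t j = lo j + hi j.
apply: (@leq_card_rel _ _ _ _ R).
- move=> s /= s_ok; have s_lohi := lohi _ s s_ok.
  pose f j := lo j + hi j - nth 0 s j.
  have f_bd j : lo j <= f j <= hi j by have := s_lohi j; rewrite /f; lia.
  have f_dec j : f j.+1 <= f j.
    have /andP[_ le1] := f_bd j.+1; have /andP[le2 _] := f_bd j.
    apply: leq_trans le1 (leq_trans _ le2).
    by rewrite /hi /lo geq_min; apply/orP; left; rewrite leq_max leqnn orbT.
  (* From row M on, mu, nu and s are empty; hi is shifted by one row, whence
     the sums up to M.+1. *)
  pose M := size mu + size nu + size s; pose N := M.+1.
  have fN : f N = 0.
    have /andP[_] := f_bd N; rewrite /hi /N (@nth_default _ 0 mu) ?min0n; lia.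
  have [t0 t0P] := ex_young f_dec fN.
  have sum_lohi : \sum_(j < N) lo j + \sum_(j < N) hi j = m + v.
    have -> : \sum_(j < N) lo j = \sum_(j < M) lo j.
      by rewrite big_ord_recr /= [lo M]/lo !nth_default // /M; lia.
    rewrite [\sum_(j < N) hi j]big_ord_recl addnCA -big_split /=.
    have -> : \sum_(j < M) (lo j + hi (bump 0 j)) =
              \sum_(j < M) (nth 0 mu j.+1 + nth 0 nu j).
      by apply: eq_bigr => j _; rewrite /lo /bump leq0n add1n /=; lia.
    rewrite big_split addnA -(sumn_nth (s := nu)) ?young_sumn; last by lia.
    congr (_ + _); rewrite -{3}(young_sumn mu) (@sumn_nth _ N); last by lia.
    by rewrite big_ord_recl.
  have sum_f : \sum_(j < N) f j = b + v.
    have : \sum_(j < N) (f j + nth 0 s j) = \sum_(j < N) (lo j + hi j).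
      by apply: eq_bigr => j _; have := s_lohi j; rewrite /f; lia.
    rewrite !big_split /= sum_lohi -(sumn_nth (s := s)) ?young_sumn; lia.
  move: t0 t0P; rewrite sum_f => t tP.
  exists t => [/=|j]; last by rewrite tP /f; have := s_lohi j; lia.
  apply/andP; split; apply/stripP=> j; rewrite !tP.
    by have /andP[] := f_bd j; rewrite /lo /hi; case: j => [|j]; lia.
  have /andP[le1 _] := f_bd j; have /andP[_ ] := f_bd j.+1.
  by move: le1; rewrite /lo /hi; lia.
by move=> s s' t _ _ st s't; apply: young_eq => j; have := st j; have := s't j; lia.
Qed.

Lemma chains_swap a b w m (mu : young m) :
  chains [:: a, b & w] mu = chains [:: b, a & w] mu.
Proof.
set v := sumn w.
have expand x y : chains [:: x, y & w] mu =
    \sum_(nu : young v) (m == x + y + v) *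
      #|[pred s : young (y + v) | strip mu s && strip s nu]| * chains w nu.
  rewrite (@chains_cons (y + v)) //.
  under eq_bigr => s _ do rewrite (@chains_cons v) // young_sumn eqxx.
  rewrite (exchange_big_dep predT) //=; apply: eq_bigr => nu _.
  rewrite sum_nat_const young_sumn addnA; congr (_ * _).
  case: (m == _); last first.
    by rewrite mul0n eq_card0 // => s; rewrite unfold_in /= andbF.
  by rewrite mul1n; apply: eq_card => s; rewrite !unfold_in /= !andbT.
rewrite !expand; apply: eq_bigr => nu _; congr (_ * _).
rewrite [b + a]addnC; case: eqP => // def_m; rewrite !mul1n; apply/eqP.
by rewrite eqn_leq !bender_knuth // def_m; lia.
Qed.

Lemma chains_congr a w w' : sumn w = sumn w' ->
  (forall m (mu : young m), chains w mu = chains w' mu) ->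
  forall m (mu : young m), chains (a :: w) mu = chains (a :: w') mu.
Proof.
move=> eq_s eq_w m mu; rewrite !(@chains_cons (sumn w)) //.
by apply: eq_bigr => nu _; apply: eq_w.
Qed.

Lemma sumn_perm (s t : seq nat) : perm_eq s t -> sumn s = sumn t.
Proof. by rewrite !sumnE; apply: perm_big. Qed.

Lemma chains_perm w w' m (mu : young m) :
  perm_eq w w' -> chains w mu = chains w' mu.
Proof.
have move_front a w1 w2 : forall k (ka : young k),
    chains (w1 ++ a :: w2) ka = chains (a :: w1 ++ w2) ka.
  elim: w1 => [|b w1 IHw] k ka //=; rewrite [RHS]chains_swap.
  apply: chains_congr => [|j ja]; last exact: IHw.
  by rewrite /= !sumn_cat /=; lia.
elim: w w' m mu => [|a w IHw] w' m mu.
  by rewrite perm_sym => /perm_nilP->.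
move=> eq_w; have: a \in w' by rewrite -(perm_mem eq_w) mem_head.
move=> a_w'; case/splitPr: a_w' eq_w => w1 w2; rewrite move_front.
rewrite perm_sym perm_catC /= perm_cons perm_sym => eq_w.
have {}eq_w : perm_eq w (w1 ++ w2) by rewrite (perm_trans eq_w) // perm_catC.
apply: chains_congr => [|k ka]; [exact: sumn_perm | exact: IHw].
Qed.

Lemma eq_of_leq_sum (f g : nat -> nat) N : (forall j, f j <= g j) ->
  \sum_(j < N) f j = \sum_(j < N) g j -> forall j, j < N -> f j = g j.
Proof.
move=> le_fg; elim: N => [|N IHN] // eq_s j.
have {}eq_s : \sum_(j < N) f j + f N = \sum_(j < N) g j + g N.
  by move: eq_s; rewrite !big_ord_recr.
have le_s : \sum_(j < N) f j <= \sum_(j < N) g j by apply: leq_sum.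
have le_N := le_fg N; rewrite ltnS leq_eqVlt => /orP[/eqP-> | ]; first by lia.
by apply: IHN; lia.
Qed.

Lemma chains0 w m (mu : young m) : chains (0 :: w) mu = chains w mu.
Proof.
case: (eqVneq m (sumn w)) => [def_m | neq_m].
  subst m; rewrite (@chains_cons (sumn w)) //.
  rewrite (big_pred1 mu) // => nu /=; rewrite young_sumn eqxx andbT.
  apply/stripP/eqP => [mu_nu | -> j]; last by rewrite young_dec leqnn.
  pose N := maxn (size mu) (size nu).
  have le j : nth 0 nu j <= nth 0 mu j by case/andP: (mu_nu j).
  apply: young_eq => j; case: (ltnP j N) => [|le_Nj]; last first.
    by rewrite !nth_default //; move: le_Nj; rewrite geq_max => /andP[].
  apply: (eq_of_leq_sum le).
  by rewrite -!sumn_nth ?young_sumn ?leq_maxl ?leq_maxr.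
rewrite (@chains_cons (sumn w)) // big_pred0 => [|nu]; last first.
  by rewrite young_sumn (negPf neq_m) andbF.
by rewrite chains_size ?young_sumn.
Qed.

Lemma chains_filter w m (mu : young m) :
  chains [seq x <- w | 0 < x] mu = chains w mu.
Proof.
elim: w m mu => [|[|a] w IHw] m mu //=; first by rewrite chains0 IHw.
apply: chains_congr => //; elim: w {IHw} => [|[|b] w IHw] //=.
by rewrite IHw.
Qed.

(** * Tableaux as chains of strips *)

Lemma cell_lt mu (c : cell mu) : ccol c < nth 0 mu (crow c).
Proof. exact: ltn_ord (tagged c). Qed.

Lemma cell_inj mu (c d : cell mu) :
  crow c = crow d -> ccol c = ccol d -> c = d.
Proof.
case: c d => [i j] [i' j']; rewrite /crow /ccol /= => /val_inj eq_i.
by subst i' => /val_inj->.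
Qed.

Lemma ex_cell mu i j : j < nth 0 mu i ->
  exists c : cell mu, crow c = i /\ ccol c = j.
Proof.
move=> lt_j; have lt_i : i < size mu.
  by rewrite ltnNge; apply/negP=> le_i; rewrite nth_default in lt_j.
by exists (Tagged (fun i : 'I_(size mu) => 'I_(nth 0 mu i))
                  (Ordinal lt_j : 'I_(nth 0 mu (Ordinal lt_i)))).
Qed.

Lemma card_cell mu : #|cell mu| = sumn mu.
Proof.
rewrite card_tagged sumnE big_map big_enum /= (@sumn_nth mu (size mu)) //.
by apply: eq_bigr => i _; rewrite card_ord.
Qed.

Lemma semistandardP mu k (T : {ffun cell mu -> 'I_k}) :
  reflect (forall c d,
            (ccol c = ccol d -> crow c < crow d -> T c < T d) /\
            (crow c = crow d -> ccol c < ccol d -> T c <= T d))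
          (semistandard T).
Proof.
apply: (iffP forallP) => [ssT c d | ssT c].
  have /forallP/(_ d)/andP[/implyP col /implyP row] := ssT c.
  by split=> eq_cd lt_cd; [apply: col | apply: row]; rewrite eq_cd eqxx.
apply/forallP=> d; have [col row] := ssT c d.
by apply/andP; split; apply/implyP=> /andP[/eqP ? ?]; [apply: col | apply: row].
Qed.

(** Weights are functions here so that removing the largest symbol only
    decreases [k] and leaves the weight unchanged. *)
Definition tableaux mu k (w : nat -> nat) : {set {ffun cell mu -> 'I_k}} :=
  [set T | semistandard T && [forall i : 'I_k, #|[set c | T c == i]| == w i]].

Lemma tableauxP mu k (w : nat -> nat) (T : {ffun cell mu -> 'I_k}) :
  reflect (semistandard T /\ forall i : 'I_k, #|[set c | T c == i]| = w i)
          (T \in tableaux mu k w).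
Proof.
rewrite inE; apply: (iffP andP) => -[ssT].
  by move/forallP=> wT; split=> // i; apply/eqP.
by move=> wT; split=> //; apply/forallP=> i; apply/eqP.
Qed.

Lemma card_lt_entries mu k (T : {ffun cell mu -> 'I_k}) (w : nat -> nat) m :
  m <= k -> (forall i : 'I_k, #|[set c | T c == i]| = w i) ->
  #|[set c | T c < m]| = \sum_(i < m) w i.
Proof.
move=> le_mk wT; rewrite -sum1_card.
rewrite (partition_big T (fun i : 'I_k => i < m)) => [|c]; last by rewrite inE.
rewrite (big_ord_widen _ w le_mk); apply: eq_bigr => i lt_i.
rewrite -wT -sum1_card; apply: eq_bigl => c; rewrite !inE.
by case: eqP => [->|]; rewrite ?lt_i ?andbF.
Qed.

Lemma tableaux_size mu k w (T : {ffun cell mu -> 'I_k}) :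
  T \in tableaux mu k w -> sumn mu = \sum_(i < k) w i.
Proof.
case/tableauxP=> _ wT; rewrite -(card_lt_entries _ wT) // -card_cell.
by apply/esym/eq_card=> c; rewrite !inE ltn_ord.
Qed.

(** Among the diagrams [nu] contained in [mu], this singles out the shape that is
    left when the largest symbol is erased from [T]. *)
Definition cut mu k (T : {ffun cell mu -> 'I_k.+1}) (nu : seq nat) : bool :=
  [forall c, (T c < k) == (ccol c < nth 0 nu (crow c))].

Lemma cutP mu k (T : {ffun cell mu -> 'I_k.+1}) nu :
  reflect (forall c, (T c < k) = (ccol c < nth 0 nu (crow c))) (cut T nu).
Proof. by apply: (iffP forallP) => cutT c; [apply/eqP: (cutT c) | rewrite cutT]. Qed.

Lemma ex_embed mu nu : (forall i, nth 0 nu i <= nth 0 mu i) ->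
  exists e : cell nu -> cell mu,
    forall d, crow (e d) = crow d /\ ccol (e d) = ccol d.
Proof.
move=> le_nu.
have/fin_all_exists[e eP] : forall d : cell nu, exists c : cell mu,
    crow c = crow d /\ ccol c = ccol d.
  by move=> d; apply: ex_cell; apply: leq_trans (cell_lt d) (le_nu _).
by exists e.
Qed.

Lemma card_below_cut mu k (T : {ffun cell mu -> 'I_k.+1}) nu :
  (forall i, nth 0 nu i <= nth 0 mu i) -> cut T nu ->
  #|[set c | T c < k]| = sumn nu.
Proof.
case/ex_embed=> e eP /cutP cT; rewrite -card_cell -cardsT.
rewrite -(card_imset (f := e)) => [|d d' eq_e]; last first.
  have [eR eC] := eP d; have [eR' eC'] := eP d'.
  by apply: cell_inj; rewrite -?eR -?eC eq_e ?eR' ?eC'.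
apply: eq_card => c; rewrite inE cT; apply/idP/imsetP => [|[d _ ->]].
  case/ex_cell=> d [dR dC]; exists d; rewrite ?inE //.
  by have [eR eC] := eP d; apply: cell_inj; rewrite ?eR ?eC.
by have [-> ->] := eP d; apply: cell_lt.
Qed.

(** Restricting to [nu] loses nothing, the other cells being filled with [k].
    Conversely, filling [mu / nu] with [k] keeps columns strictly increasing
    exactly because [mu / nu] is a horizontal strip. *)
Lemma card_cut k (w : nat -> nat) m v (mu : young m) (nu : young v) :
  strip mu nu -> m = w k + v ->
  #|[pred T | (T \in tableaux mu k.+1 w) && cut T nu]| = #|tableaux nu k w|.
Proof.
move=> /stripP mu_nu def_m.
have le_nu i : nth 0 nu i <= nth 0 mu i by case/andP: (mu_nu i).
have [e eP] := ex_embed le_nu.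
have eR d : crow (e d) = crow d by case: (eP d).
have eC d : ccol (e d) = ccol d by case: (eP d).
have e_inj : injective e.
  by move=> d d' eq_e; apply: cell_inj; rewrite -?eR -?eC eq_e.
have ex_e (c : cell mu) : ccol c < nth 0 nu (crow c) -> exists d, e d = c.
  case/ex_cell=> d [dR dC]; exists d.
  by apply: cell_inj; rewrite ?eR ?eC.
have in_nu d : ccol (e d) < nth 0 nu (crow (e d)) by rewrite eR eC cell_lt.
pose R (T : {ffun cell mu -> 'I_k.+1}) (U : {ffun cell nu -> 'I_k}) : Prop :=
  forall d, T (e d) = U d :> nat.
have card_eq T U (i : 'I_k) : cut T nu -> R T U ->
    #|[set c | T c == widen_ord (leqnSn k) i]| = #|[set d | U d == i]|.
  move=> /cutP cT RTU; rewrite -(card_imset _ e_inj); apply: eq_card => c.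
  rewrite !inE -val_eqE /=; apply/eqP/imsetP => [Tc | [d]].
    have [|d def_c] := ex_e c; first by rewrite -cT Tc.
    by exists d; rewrite // inE -val_eqE /= -RTU def_c Tc.
  by rewrite inE => /eqP Ud ->; rewrite RTU Ud.
transitivity #|[pred U | U \in tableaux nu k w]|; last exact: eq_card.
apply: (@eq_card_rel _ _ _ _ R).
- move=> T /andP[/tableauxP[/semistandardP ssT wT] cT].
  have /fin_all_exists[U0 U0P] : forall d, exists i : 'I_k, T (e d) = i :> nat.
    by move=> d; have := in_nu d; rewrite -(cutP _ _ cT) => lt; exists (Ordinal lt).
  pose U := [ffun d => U0 d]; have RTU : R T U by move=> d; rewrite ffunE.
  exists U => //; apply/tableauxP; split=> [|i]; last by rewrite -(card_eq T) ?wT.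
  by apply/semistandardP=> c d; have := ssT (e c) (e d); rewrite !RTU !eR !eC.
- move=> U /tableauxP[/semistandardP ssU wU].
  pose T : {ffun cell mu -> 'I_k.+1} := [ffun c => if [pick d | e d == c] is Some d
               then widen_ord (leqnSn k) (U d) else ord_max].
  have RTU : R T U.
    move=> d; rewrite ffunE; case: pickP => [d' /eqP/e_inj-> // | /(_ d)].
    by rewrite eqxx.
  have Tmax c : nth 0 nu (crow c) <= ccol c -> T c = ord_max.
    rewrite ffunE; case: pickP => // d /eqP <-.
    by rewrite leqNgt in_nu.
  have cT : cut T nu.
    apply/cutP=> c.
    case: (ltnP (ccol c) (nth 0 nu (crow c))) => [/ex_e[d <-] | /Tmax->].
      by rewrite RTU ltn_ord.
    by rewrite ltnn.
  exists T => //; rewrite cT andbT; apply/tableauxP; split.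
    apply/semistandardP=> c d; case: (ltnP (ccol d) (nth 0 nu (crow d))) => [d_nu|].
      have [d' def_d] := ex_e d d_nu.
      split=> [eq_c lt_r | eq_r lt_c].
        have [|c' def_c] := ex_e c.
          by rewrite eq_c (leq_trans d_nu) // young_mono // ltnW.
        rewrite -def_c -def_d !RTU; have [col _] := ssU c' d'.
        by apply: col; rewrite -?eC -?eR def_c def_d.
      have [|c' def_c] := ex_e c; first by rewrite eq_r (ltn_trans lt_c).
      rewrite -def_c -def_d !RTU; have [_ row] := ssU c' d'.
      by apply: row; rewrite -?eC -?eR def_c def_d.
    move/Tmax=> Td; rewrite Td /=; split=> [eq_c lt_r | _ _]; last exact: leq_ord.
    rewrite (cutP _ _ cT) eq_c.
    have /andP[le_mu _] := mu_nu (crow c); apply: leq_trans le_mu.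
    exact: leq_trans (cell_lt d) (young_mono mu lt_r).
  have wlt (i : 'I_k) : #|[set c | T c == widen_ord (leqnSn k) i]| = w i.
    by rewrite (card_eq T U).
  move=> i; case: (ltnP i k) => [lt_i | le_i].
    have -> : i = widen_ord (leqnSn k) (Ordinal lt_i) by apply: val_inj.
    exact: wlt.
  have -> : i = ord_max by apply: val_inj => /=; have := leq_ord i; lia.
  have : #|[set c | T c == ord_max]| + #|[set c | T c < k]| = w k + v.
    have <- : #|cell mu| = w k + v by rewrite card_cell young_sumn.
    rewrite -(cardC [set c | T c == ord_max]).
    congr (_ + _); apply: eq_card => c; rewrite !inE -val_eqE /=.
    by rewrite ltn_neqAle leq_ord andbT.
  by rewrite (card_below_cut le_nu cT) young_sumn => /addIn.
- move=> T T' U /andP[_ /cutP cT] /andP[_ /cutP cT'] RT RT'; apply/ffunP=> c.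
  apply: val_inj => /=; case: (ltnP (ccol c) (nth 0 nu (crow c))) => c_nu.
    by have [d <-] := ex_e c c_nu; rewrite RT RT'.
  have top (S : {ffun cell mu -> 'I_k.+1}) : (S c < k) = false -> S c = k :> nat.
    by move=> Sc; apply/eqP; rewrite eqn_leq leq_ord leqNgt Sc.
  have c_cut : (ccol c < nth 0 nu (crow c)) = false by rewrite ltnNge c_nu.
  by rewrite (top T) ?cT // (top T') ?cT'.
- move=> T U U' _ _ RU RU'; apply/ffunP=> d; apply: val_inj.
  by rewrite /= -RU RU'.
Qed.

(** Rows being weakly increasing, the cells with entries below [k] form an initial
    segment of each row. Columns being strictly increasing, a cell in row i.+1
    cannot lie under an entry equal to [k], which gives the interlacing. *)
Lemma ex_cut k (w : nat -> nat) m (mu : young m) (T : {ffun cell mu -> 'I_k.+1}) :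
  T \in tableaux mu k.+1 w ->
  exists2 nu : young (\sum_(i < k) w i), strip mu nu & cut T nu.
Proof.
case/tableauxP=> /semistandardP ssT wT.
(* f i is the first column with entry k in row i of T, or the length of that
   row if there is none. *)
pose full i j := [exists c, [&& crow c == i, ccol c == j & T c == ord_max]].
pose f i := find (full i) (iota 0 (nth 0 mu i)).
have f_le i : f i <= nth 0 mu i by rewrite -[leqRHS](size_iota 0) find_size.
have fP c : (T c < k) = (ccol c < f (crow c)).
  have := leq_ord (T c); case: (ltnP (ccol c) (f (crow c))) => [lt_c | le_c] le_k.
    rewrite ltn_neqAle le_k andbT.
    have lt_mu := leq_trans lt_c (f_le _).
    have := before_find 0 lt_c; rewrite nth_iota // add0n.
    apply: contraFneq => Tc; apply/existsP; exists c.
    by rewrite !eqxx -val_eqE /= Tc eqxx.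
  have lt_f : f (crow c) < nth 0 mu (crow c) := leq_ltn_trans le_c (cell_lt c).
  have : has (full (crow c)) (iota 0 (nth 0 mu (crow c))).
    by rewrite has_find size_iota.
  move/(nth_find 0); rewrite -/(f _) nth_iota // add0n.
  case/existsP=> d /and3P[/eqP dR /eqP dC /eqP Td].
  apply/negbTE; rewrite -leqNgt; move: le_c; rewrite leq_eqVlt.
  case/orP=> [/eqP eq_c | lt_c].
    by rewrite -(@cell_inj _ d c) ?Td //= dC.
  have [_ row] := ssT d c; suff : T d <= T c by rewrite Td.
  by apply: row; rewrite ?dR ?dC.
have f_ge i : nth 0 mu i.+1 <= f i.
  rewrite leqNgt; apply/negP=> lt_f.
  have [d [dR dC]] := ex_cell lt_f.
  have [c [cR cC]] := ex_cell (leq_trans lt_f (young_dec mu i)).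
  have [col _] := ssT c d; have := col; rewrite cR cC dR dC => /(_ erefl (leqnn _)).
  by have := fP c; rewrite cR cC ltnn; have := leq_ord (T d); lia.
have f_dec i : f i.+1 <= f i := leq_trans (f_le _) (f_ge i).
have f0 : f (size mu) = 0.
  by apply/eqP; rewrite -leqn0 (leq_trans (f_le _)) ?nth_default.
have [nu nuP] := ex_young f_dec f0.
have cT : cut T nu by apply/cutP=> c; rewrite nuP.
have le_nu i : nth 0 nu i <= nth 0 mu i by rewrite nuP.
have mu_nu : strip mu nu by apply/stripP=> j; rewrite nuP f_ge f_le.
move: (card_below_cut le_nu cT); rewrite young_sumn (card_lt_entries _ wT) //.
by move=> ->; exists nu.
Qed.

Lemma cut_uniq k m v (mu : young m) (T : {ffun cell mu -> 'I_k.+1})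
    (nu nu' : young v) :
  strip mu nu -> cut T nu -> strip mu nu' -> cut T nu' -> nu = nu'.
Proof.
move=> /stripP mu_nu /cutP cT /stripP mu_nu' /cutP cT'; apply: young_eq => i.
have lt j : j < nth 0 mu i -> (j < nth 0 nu i) = (j < nth 0 nu' i).
  by case/ex_cell=> c [<- <-]; rewrite -cT cT'.
have := lt (nth 0 nu i); have := lt (nth 0 nu' i).
have := mu_nu i; have := mu_nu' i; lia.
Qed.

Lemma card_tableauxS k (w : nat -> nat) m v (mu : young m) : v = \sum_(i < k) w i ->
  #|tableaux mu k.+1 w| =
  \sum_(nu : young v | strip mu nu && (sumn mu == w k + v)) #|tableaux nu k w|.
Proof.
move=> def_v; rewrite young_sumn; case: eqP => [def_m | neq_m]; last first.
  rewrite big_pred0 => [|nu]; last by rewrite andbF.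
  apply: eq_card0 => T; apply/negP=> /tableaux_size.
  by rewrite young_sumn big_ord_recr /= -def_v addnC.
under eq_bigl => nu do rewrite andbT.
transitivity (\sum_(nu : young v | strip mu nu)
                \sum_(T in tableaux mu k.+1 w | cut T nu) 1).
  rewrite (exchange_big_dep (mem (tableaux mu k.+1 w))) /=; last first.
    by move=> ? ? _ /andP[].
  rewrite -sum1_card; apply: eq_bigr => T Tw.
  have [nu] := ex_cut Tw; rewrite -def_v in nu * => mu_nu cT.
  rewrite (big_pred1 nu) // => nu'; rewrite Tw /=.
  apply/andP/eqP=> [[mu_nu' cT'] | ->]; last by [].
  exact: cut_uniq mu_nu' cT' mu_nu cT.
apply: eq_bigr => nu mu_nu; rewrite sum1_card -(card_cut mu_nu def_m).
exact: eq_card.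
Qed.

Lemma eq_tableaux mu k (w w' : nat -> nat) :
  (forall i, i < k -> w i = w' i) -> tableaux mu k w = tableaux mu k w'.
Proof.
move=> eq_w; apply/setP=> T; rewrite !inE; congr (_ && _).
by apply: eq_forallb => i; rewrite eq_w.
Qed.

Lemma kostka_chains m (mu : young m) lam : kostka mu lam = chains (rev lam) mu.
Proof.
rewrite -[kostka _ _]/(#|tableaux mu (size lam) (nth 0 lam)|).
elim/last_ind: lam m mu => [|lam a IHlam] m mu.
  case: (eqVneq (rows mu) [::]) => [-> | mu_neq0].
    (* The empty shape carries a single tableau, the empty function. *)
    rewrite /chains /= (_ : tableaux _ _ _ = [set [ffun c => tag c]]) ?cards1 //.
    apply/setP=> T; rewrite in_set1; have -> : T = [ffun c => tag c].
      by apply/ffunP=> -[[]].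
    rewrite eqxx; apply/tableauxP; split=> [|[] //].
    by apply/semistandardP=> -[[]].
  rewrite /chains /= (negPf mu_neq0); apply: eq_card0 => T; apply/negP=> _.
  have [|c _] := @ex_cell mu 0 0; last by case: (T c).
  by rewrite nth_gt0 ?young0 // lt0n size_eq0.
rewrite rev_rcons size_rcons.
have sum_w : sumn (rev lam) = \sum_(i < size lam) nth 0 (rcons lam a) i.
  rewrite sumn_rev (sumn_nth (leqnn _)); apply: eq_bigr => i _.
  by rewrite nth_rcons ltn_ord.
rewrite (card_tableauxS _ sum_w) (chains_cons _ _ erefl).
rewrite nth_rcons ltnn eqxx; apply: eq_bigr => nu _; rewrite -IHlam.
by congr #|pred_of_set _|; apply: eq_tableaux => i lt_i; rewrite nth_rcons lt_i.
Qed.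

(** * Adding a cell to a diagram *)

Definition decr (s : seq nat) i := set_nth 0 s i (nth 0 s i).-1.

Lemma nth_decr s i j : nth 0 (decr s i) j = nth 0 s j - (i == j).
Proof. by rewrite nth_set_nth /= eq_sym; case: eqP => [->|_]; lia. Qed.

Lemma sumn_decr s i : 0 < nth 0 s i -> sumn (decr s i) = (sumn s).-1.
Proof.
move=> s_i; have lt_i : i < size s.
  by rewrite ltnNge; apply/negP=> le_i; rewrite nth_default in s_i.
have : nth 0 s i <= sumn s by apply/leq_mem_sumn/mem_nth.
by rewrite sumn_set_nth lt_i; lia.
Qed.

Lemma sumn_incr (s : seq nat) i : sumn (incr_nth s i) = (sumn s).+1.
Proof.
elim: s i => [|x s IHs] [|i] //=; last by rewrite IHs addnS.
by rewrite sumn_ncons.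
Qed.

(** Both sides are counted by the row i in which the cell is added ([A i]) or
    removed ([B i]). If [rho / nu] is a strip, a cell can always be added to the
    top row of [rho], and it can be added to row i.+1 exactly when
    rho_(i+1) < nu_i, which is when a cell can be removed from row i of [nu].
    If [rho / nu] is not a strip, either operation must repair the only
    defect, namely nu_i = rho_i + 1 for a single i, so that [A i] and [B i] are
    equivalent. *)
Lemma card_cover_strips r v (rho : young r) (nu : young v) :
  #|[pred mu : young r.+1 | young_lt rho mu && strip mu nu]| =
  #|[pred s : young v.-1 | young_lt s nu && strip rho s]| + strip rho nu.
Proof.
pose N := size nu.
pose A i := strip (incr_nth rho i) nu.
pose B i := (0 < nth 0 nu i) && strip rho (decr nu i).
have AP i : reflect (forall j, nth 0 rho j.+1 + (i == j.+1) <= nth 0 nu j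
                                <= nth 0 rho j + (i == j)) (A i).
  by apply: (iffP (stripP _ _)) => H j; move: (H j); rewrite !nth_incr_nth; lia.
have BP i : reflect (0 < nth 0 nu i /\ forall j,
    nth 0 rho j.+1 <= nth 0 nu j - (i == j) <= nth 0 rho j) (B i).
  apply: (iffP andP) => -[nu_i]; first move/stripP.
    by move=> H; split=> // j; move: (H j); rewrite nth_decr.
  by move=> H; split=> //; apply/stripP=> j; rewrite nth_decr.
have -> : #|[pred mu : young r.+1 | young_lt rho mu && strip mu nu]| =
          #|[pred i : 'I_N.+1 | A i]|.
  pose R (mu : young r.+1) (i : 'I_N.+1) : Prop :=
    forall j, nth 0 mu j = nth 0 rho j + ((i : nat) == j).
  apply: (@eq_card_rel _ _ _ _ R).
  - move=> mu /andP[/young_ltP[i muE] /stripP mu_nu].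
    have lt_i : i < N.+1.
      case: i muE => // i muE; rewrite ltnS -nth_gt0 ?young0 //.
      by have := mu_nu i; rewrite muE eqxx; lia.
    by exists (Ordinal lt_i) => //; apply/AP=> j; rewrite -!muE.
  - move=> i Ai; have /AP rho_nu := Ai.
    have [||mu muE] := @ex_young_seq r.+1 (incr_nth rho i).
    - by rewrite sumn_incr young_sumn.
    - by move=> j; have := rho_nu j; rewrite !nth_incr_nth; lia.
    have muR : R mu i by move=> j; rewrite muE nth_incr_nth addnC.
    exists mu => //; apply/andP; split; first by apply/young_ltP; exists (i : nat).
    by apply/stripP=> j; rewrite !muR.
  - by move=> mu mu' i _ _ Rmu Rmu'; apply: young_eq => j; rewrite Rmu Rmu'.
  move=> mu i i' _ _ Ri Ri'; apply: val_inj => /=.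
  have := Ri (i : nat); rewrite Ri' eqxx => /addnI.
  by case: eqP.
have -> : #|[pred s : young v.-1 | young_lt s nu && strip rho s]| =
          #|[pred i : 'I_N | B i]|.
  pose R (s : young v.-1) (i : 'I_N) : Prop :=
    forall j, nth 0 nu j = nth 0 s j + ((i : nat) == j).
  apply: (@eq_card_rel _ _ _ _ R).
  - move=> s /andP[/young_ltP[i nuE] /stripP rho_s].
    have nu_i : 0 < nth 0 nu i by rewrite nuE eqxx addn1.
    have lt_i : i < N by rewrite -nth_gt0 ?young0.
    exists (Ordinal lt_i) => //; apply/BP; split=> // j.
    by rewrite nuE addnK.
  - move=> i /BP[nu_i rho_nu].
    have [||s sE] := @ex_young_seq v.-1 (decr nu i).
    - by rewrite sumn_decr // young_sumn.
    - move=> j; rewrite !nth_decr; have /andP[le_j _] := rho_nu j.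
      by apply: leq_trans le_j; case/andP: (rho_nu j.+1).
    have sR : R s i.
      by move=> j; rewrite sE nth_decr; case: ((i : nat) =P j) => [<-|]; lia.
    exists s => //; apply/andP; split; first by apply/young_ltP; exists (i : nat).
    by apply/stripP=> j; rewrite sE nth_decr.
  - move=> s s' i _ _ Rs Rs'; apply: young_eq => j.
    by have := Rs j; rewrite Rs'; lia.
  move=> s i i' _ _ Ri Ri'; apply: val_inj => /=.
  have := Ri (i : nat); rewrite Ri' eqxx => /addnI.
  by case: eqP.
have card_sum M (P : nat -> bool) : #|[pred i : 'I_M | P i]| = \sum_(i < M) P i.
  by rewrite -sum1_card big_mkcond.
rewrite !card_sum; have nuN : nth 0 nu N = 0 by rewrite nth_default.
case: (boolP (strip rho nu)) => [/stripP rho_nu | not_strip].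
  rewrite big_ord_recl addnC /=; congr (_ + _); last first.
    by rewrite (_ : A 0) //; apply/AP=> j; have := rho_nu j; lia.
  apply: eq_bigr => i _; rewrite /bump add1n; congr nat_of_bool.
  apply/AP/BP=> [H | [nu_i H] j].
    have := H i; rewrite eqxx addn1 => /andP[lt_i _].
    split=> [|j]; first exact: leq_ltn_trans lt_i.
    by have := rho_nu j; case: ((i : nat) =P j) => [<-|]; lia.
  have := rho_nu j; rewrite eqSS; have := H i; rewrite eqxx.
  by case: ((i : nat) =P j) => [<-|]; lia.
have AN : A N = false.
  apply: contraNF not_strip => /AP H; apply/stripP=> j; have := H j.
  by case: (N =P j) => [<-|]; lia.
rewrite big_ord_recr /= AN !addn0; apply: eq_bigr => i _; congr nat_of_bool.
apply/AP/BP=> [H | [nu_i H] j].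
  have nu_i : nth 0 nu i = (nth 0 rho i).+1.
    apply/eqP; apply: contraNT not_strip => neq; apply/stripP=> j; have := H j.
    by case: ((i : nat) =P j) => [def_j|]; [subst j|]; lia.
  split=> [|j]; first by rewrite nu_i.
  have := H j; have := young_dec rho j.
  by case: ((i : nat) =P j) => [<-|]; lia.
have {}nu_i : nth 0 nu i = (nth 0 rho i).+1.
  apply/eqP; apply: contraNT not_strip => neq; apply/stripP=> j'; have := H j'.
  by case: ((i : nat) =P j') => [def_j|]; [subst j'|]; lia.
have := H j; have := young_dec nu j.
case: ((i : nat) =P j.+1) => [def_i|_]; last by lia.
by rewrite -def_i; lia.
Qed.

Lemma young_lt_gt0 m n (g : young m) (l : young n) : young_lt g l -> 0 < n.
Proof.
case/young_ltP=> i lE; have l_i : 0 < nth 0 l i by rewrite lE eqxx addn1.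
rewrite -(young_sumn l); apply: leq_trans l_i (leq_mem_sumn (mem_nth _ _)).
by rewrite -nth_gt0 ?young0 // lE eqxx addn1.
Qed.

(** Induction on the number of strips: [card_cover_strips] exchanges the last
    strip with the added cell. Either the cell moves below the last strip, and by
    induction it shortens one of the earlier strips, or it is absorbed by the
    last strip, which becomes shorter. *)
Lemma pieri w n (rho : young n.-1) : n = sumn w ->
  \sum_(mu : young n | young_lt rho mu) chains w mu =
  \sum_(i < size w | 0 < nth 0 w i) chains (decr w i) rho.
Proof.
elim: w n rho => [|a w IHw] n rho def_n.
  rewrite big_ord0 big_pred0 // => mu.
  by case: (boolP (young_lt rho mu)) => // /young_lt_gt0; rewrite def_n.
case: n => [|r] in rho def_n *.
  rewrite !big_pred0 // => [i|mu]; last first.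
    by case: (boolP (young_lt rho mu)) => // /young_lt_gt0.
  by apply/negbTE; rewrite -leqNgt def_n leq_mem_sumn ?mem_nth.
change (young r) in (type of rho); rewrite /= in def_n; set v := sumn w in def_n.
transitivity (\sum_(nu : young v)
    #|[pred mu : young r.+1 | young_lt rho mu && strip mu nu]| * chains w nu).
  have expand (mu : young r.+1) :
      chains (a :: w) mu = \sum_(nu : young v | strip mu nu) chains w nu.
    rewrite (@chains_cons v) //; apply: eq_bigl => nu.
    by rewrite (_ : sumn mu == _) ?andbT // young_sumn def_n.
  under eq_bigr => mu _ do rewrite expand.
  rewrite (exchange_big_dep predT) //=; apply: eq_bigr => nu _.
  by rewrite sum_nat_const; congr (_ * _); apply: eq_card.
under eq_bigr => nu _ do rewrite card_cover_strips mulnDl.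
have -> : \sum_(i < size (a :: w) | 0 < nth 0 (a :: w) i) chains (decr (a :: w) i) rho
        = (if 0 < a then chains (a.-1 :: w) rho else 0)
          + \sum_(i < size w | 0 < nth 0 w i) chains (a :: decr w i) rho.
  by rewrite big_mkcond big_ord_recl [X in _ = _ + X]big_mkcond.
rewrite big_split /= addnC; congr (_ + _).
  case: (ltnP 0 a) => [a_gt0 | ].
    rewrite (@chains_cons v) // [RHS]big_mkcond; apply: eq_bigr => nu _.
    rewrite young_sumn (_ : r == a.-1 + v); first by case: strip; rewrite ?mul1n.
    by apply/eqP; lia.
  rewrite leqn0 => /eqP a0; rewrite big1 // => nu _.
  case: (boolP (strip rho nu)) => // /leq_sumn_strip; rewrite !young_sumn; lia.
transitivity (\sum_(s : young v.-1 | strip rho s)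
    \sum_(nu : young v | young_lt s nu) chains w nu).
  rewrite [RHS](exchange_big_dep predT) //=; apply: eq_bigr => nu _.
  rewrite sum_nat_const; congr (_ * _); apply: eq_card => s.
  by rewrite !unfold_in /= andbC.
under [LHS]eq_bigr => s _ do rewrite (IHw v s erefl).
rewrite exchange_big /=; apply: eq_bigr => i w_i.
rewrite (@chains_cons v.-1) ?sumn_decr //.
apply: eq_bigl => s; rewrite young_sumn (_ : r == _) ?andbT //.
have lt_i : nth 0 w i <= sumn w by apply/leq_mem_sumn/mem_nth.
by rewrite -/v in lt_i; lia.
Qed.

(** * Collecting the rows of the weight *)

Lemma nth_filter_gt0 (s : seq nat) j :
  sorted geq s -> nth 0 [seq x <- s | 0 < x] j = nth 0 s j.
Proof.
elim: s j => //= x s IHs j s_dec; have s_dec' := path_sorted s_dec.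
case: x s_dec => [|x] s_dec; last by case: j => //= j; apply: IHs.
have /allP s0 : all (geq 0) s.
  by apply: order_path_min s_dec => ? ? ? /[swap]; apply: leq_trans.
have all0 : forall x, x \in 0 :: s -> x = 0.
  by move=> x; rewrite inE => /predU1P[//|/s0]; rewrite /= leqn0 => /eqP.
have -> : [seq x <- s | 0 < x] = [::].
  apply/eqP; rewrite -[_ == _]negbK -has_filter.
  by apply/hasPn=> x /s0; rewrite -leqNgt.
rewrite nth_nil; case: (ltnP j (size (0 :: s))) => [lt_j | le_j].
  by rewrite (all0 _ (mem_nth 0 lt_j)).
by rewrite nth_default.
Qed.

Lemma perm_set_nth (s : seq nat) i y : i < size s ->
  perm_eq (nth 0 s i :: set_nth 0 s i y) (y :: s).
Proof.
move=> lt_i; rewrite set_nthE lt_i; apply/permP=> p.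
have : count p s = count p (take i s ++ drop i s) by rewrite cat_take_drop.
by rewrite (drop_nth 0 lt_i) /= !count_cat /=; lia.
Qed.

(** Up to reordering, shortening a row is shortening the last row [k] of the same
    length, and the latter gives a diagram covered by [l]. *)
Lemma ex_decr_row n (l : young n) i : i < size l ->
  exists2 g : young n.-1, young_lt g l & perm_eq (decr_row l i) g.
Proof.
move=> lt_i; pose P k := (k < size l) && (nth 0 l k == nth 0 l i).
have exP : exists k, P k by exists i; rewrite /P lt_i eqxx.
have ubP k : P k -> k <= size l by case/andP=> /ltnW.
case: (ex_maxnP exP ubP) => k /andP[lt_k /eqP eq_k] k_max.
have l_k : 0 < nth 0 l k by rewrite nth_gt0 ?young0.
have lt_next : nth 0 l k.+1 < nth 0 l k.
  rewrite ltn_neqAle young_dec andbT; apply/negP=> /eqP eq_next.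
  have : P k.+1 by rewrite /P -nth_gt0 ?young0 // eq_next l_k eq_k eqxx.
  by move/k_max; rewrite ltnn.
have decr_dec j : nth 0 (decr l k) j.+1 <= nth 0 (decr l k) j.
  by rewrite !nth_decr; have := young_dec l j; case: (k =P j) => [<-|]; lia.
have sum_decr : sumn (decr l k) = n.-1 by rewrite sumn_decr ?young_sumn.
have [g gE] := ex_young_seq sum_decr decr_dec.
exists g.
  apply/young_ltP; exists k => j; rewrite gE nth_decr.
  by case: (k =P j) => [<-|]; lia.
have -> : rows g = [seq x <- decr l k | 0 < x].
  apply: eq_nth0; rewrite ?young0 ?mem_filter // => j.
  rewrite nth_filter_gt0 ?gE //; apply/(sortedP 0)=> j' _; exact: decr_dec.
rewrite -[decr_row _ _]/[seq x <- decr l i | 0 < x] perm_filter //.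
rewrite -(perm_cons (nth 0 l i)) (permPl (perm_set_nth _ lt_i)).
by rewrite perm_sym -eq_k (permPl (perm_set_nth _ lt_k)).
Qed.

Lemma young_perm n (s t : young n) : perm_eq s t -> s = t.
Proof.
move=> eq_st; apply: val_inj; apply: (@sorted_eq _ geq) eq_st.
- by move=> ? ? ? le1 le2; apply: leq_trans le2 le1.
- by move=> x y; rewrite /= andbC -eqn_leq => /eqP.
- by case/and3P: (youngP s).
- by case/and3P: (youngP t).
Qed.

Theorem theorem4 (n : nat) (n_ge1 : 1 <= n) (lambda : young n) (rho : young n.-1) :
  \sum_(mu : young n | young_lt rho mu) kostka mu lambda =
  \sum_(gamma : young n.-1 | young_lt gamma lambda)
     coef lambda gamma * kostka rho gamma.
Proof.
have kostkaE m (mu : young m) lam : kostka mu lam = chains lam mu.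
  by rewrite kostka_chains; apply: chains_perm; rewrite perm_rev.
under eq_bigr => mu _ do rewrite kostkaE.
rewrite pieri ?young_sumn //.
transitivity (\sum_(gamma : young n.-1 | young_lt gamma lambda)
    \sum_(i < size lambda | perm_eq (decr_row lambda i) gamma) chains gamma rho).
  rewrite (exchange_big_dep predT) //=.
  rewrite (eq_bigl predT) => [|i]; last by rewrite nth_gt0 ?young0 ?ltn_ord.
  apply: eq_bigr => i _.
  have [g g_lt perm_g] := ex_decr_row (ltn_ord i).
  rewrite (big_pred1 g) => [|g']; last first.
    apply/andP/eqP=> [[_ perm_g'] | ->]; last by [].
    apply: young_perm; rewrite -(permPl perm_g'); exact: perm_g.
  by rewrite -(chains_perm rho perm_g) chains_filter.
apply: eq_bigr => gamma _; rewrite kostkaE sum_nat_const; congr (_ * _).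
by apply: eq_card => i; rewrite inE.
Qed.
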